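(* Let $S_1,S_2:[0,1]^2\to[0,1]$ be continuous cancellative proper t-subnorms with normalized additive generators $s_1,s_2:[0,1]\to[1,\infty]$, respectively. If $S_1\le S_2$ (pointwise on $[0,1]^2$), then $Ax\le s_1\circ s_2^{-1}(x)\le Bx$ for all $x\in[1,\infty)$, where $A=\displaystyle\lim_{x\to\infty}\frac{s_1\circ s_2^{-1}(x)}{x}$ and $B=\displaystyle\sup_{x\ge1}\frac{s_1\circ s_2^{-1}(x)}{x}$ (the supremum being over real $x\ge 1$).
   Context: A t-subnorm is a binary operation $S:[0,1]^2\to[0,1]$ that is commutative, associative, non-decreasing in both variables and satisfies $S(x,y)\le\min(x,y)$. It is cancellative if $S(x,y)=S(x,z)$ with $x>0$ implies $y=z$. A t-norm is a t-subnorm having $1$ as neutral element; a t-subnorm that is not a t-norm is called proper. By a known representation theorem, a t-subnorm $S$ is continuous and cancellative if and only if there is a continuous, strictly decreasing function $s:[0,1]\to[0,\infty]$ with $s(0)=\infty$ such that $S(x,y)=s^{-1}(s(x)+s(y))$ for all $x,y\in[0,1]$, where $s$ is viewed as a bijection $[0,1]\to[s(1),\infty]$ with inverse $s^{-1}$. Such an $s$ is called an additive generator of $S$; it is unique up to a positive multiplicative constant; $S$ is proper iff $s(1)>0$, and its normalized additive generator is then the one with $s(1)=1$. The existence of the limit $A$ and the finiteness of the supremum $B$ are understood as part of the assertion. *)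

(* Defs.v *)
From HB Require Import structures.
From mathcomp Require Import all_boot all_order all_algebra.
From mathcomp Require Import all_classical all_reals all_analysis.

Set Implicit Arguments.
Unset Strict Implicit.
Unset Printing Implicit Defensive.

Import Order.TTheory GRing.Theory Num.Theory.
Import numFieldNormedType.Exports.

Local Open Scope classical_set_scope.
Local Open Scope ring_scope.

(* A binary operation on [0,1] is represented by a function R -> R -> R, and a
   generator [0,1] -> [0,+oo] by a function R -> \bar R. Every condition below
   is restricted to [0,1], so the values outside [0,1] are irrelevant. *)

Record is_tsubnorm (R : realType) (S : R -> R -> R) : Prop := IsTSubnorm {
  tsubnorm_itv : forall x y, x \in `[0, 1] -> y \in `[0, 1] ->
    S x y \in `[0, 1];
  tsubnormC : forall x y, x \in `[0, 1] -> y \in `[0, 1] -> S x y = S y x;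
  tsubnormA : forall x y z,
    x \in `[0, 1] -> y \in `[0, 1] -> z \in `[0, 1] ->
    S x (S y z) = S (S x y) z;
  tsubnorm_le : forall x1 x2 y1 y2,
    x1 \in `[0, 1] -> x2 \in `[0, 1] -> y1 \in `[0, 1] -> y2 \in `[0, 1] ->
    x1 <= x2 -> y1 <= y2 -> S x1 y1 <= S x2 y2;
  tsubnorm_le_min : forall x y, x \in `[0, 1] -> y \in `[0, 1] ->
    S x y <= Num.min x y }.

Record is_tnorm (R : realType) (S : R -> R -> R) : Prop := IsTNorm {
  tnorm_tsubnorm : is_tsubnorm S;
  tnorm1 : forall x, x \in `[0, 1] -> S x 1 = x /\ S 1 x = x }.

Definition is_proper_tsubnorm (R : realType) (S : R -> R -> R) : Prop :=
  is_tsubnorm S /\ ~ is_tnorm S.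

Definition is_cancellative (R : realType) (S : R -> R -> R) : Prop :=
  forall x y z, x \in `[0, 1] -> y \in `[0, 1] -> z \in `[0, 1] ->
    0 < x -> S x y = S x z -> y = z.

(* Joint continuity, for the subspace topology of the unit square. *)
Definition continuous_op (R : realType) (S : R -> R -> R) : Prop :=
  {within `[0, 1] `*` `[0, 1], continuous (fun p : R * R => S p.1 p.2)}.

(* Inverse of the bijection from [0,1] onto s([0,1]) = [s 1, +oo] induced by a
   continuous strictly decreasing s; the default value 0 is only taken outside
   s([0,1]). *)
Definition generator_inv (R : realType) (s : R -> \bar R) : \bar R -> R :=
  'pinv_(fun=> 0) `[0, 1] s.

Record is_additive_generator (R : realType) (S : R -> R -> R)
    (s : R -> \bar R) : Prop := IsAdditiveGenerator {
  generator_ge0 : forall x, x \in `[0, 1] -> (0 <= s x)%E;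
  generator_continuous : {within `[0, 1], continuous s};
  generator_decr : forall x y, x \in `[0, 1] -> y \in `[0, 1] ->
    x < y -> (s y < s x)%E;
  generator0 : s 0 = +oo%E;
  generatorE : forall x y, x \in `[0, 1] -> y \in `[0, 1] ->
    S x y = generator_inv s (s x + s y)%E }.

Definition is_normalized_generator (R : realType) (S : R -> R -> R)
    (s : R -> \bar R) : Prop :=
  is_additive_generator S s /\ s 1 = 1%:E.

(* Main.v *)
(* On [1, +oo[ the map h = s1 o s2^-1 is nondecreasing, and S1 <= S2 says
   exactly that it is subadditive. With n = floor (x / u) this gives
   h x <= h ((n + 1) u) <= (x / u + 1) h u for all u, x >= 1. Taking u = 1
   bounds h x / x; letting x tend to +oo shows that h x / x converges to its
   infimum. *)
Require Import Defs.
From HB Require Import structures.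
From mathcomp Require Import all_boot all_order all_algebra.
From mathcomp Require Import all_classical all_reals all_analysis.
From mathcomp Require Import lra.

Import Order.TTheory GRing.Theory Num.Theory.
Import numFieldNormedType.Exports.

Local Open Scope classical_set_scope.
Local Open Scope ring_scope.

(** The factor is [n.+1] because subadditivity is assumed only on [1, +oo[, which excludes the
    multiple 0. *)
Lemma subadditive_mulrn (R : realType) (h : R -> R)
    (h_sub : forall u v, 1 <= u -> 1 <= v -> h (u + v) <= h u + h v)
    (u : R) (n : nat) : 1 <= u -> h (u *+ n.+1) <= h u *+ n.+1.
Proof.
move=> u1; elim: n => [|n IHn]; first by rewrite !mulr1n.
rewrite mulrS [leRHS]mulrS; apply: le_trans (h_sub _ _ u1 _) _.
  by rewrite mulrS -[leLHS]addr0 lerD // mulrn_wge0 // (le_trans _ u1).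
by rewrite lerD2l.
Qed.

Lemma nd_subadditive_le (R : realType) (h : R -> R)
    (h_ge0 : forall u, 1 <= u -> 0 <= h u)
    (h_nd : forall u v, 1 <= u -> u <= v -> h u <= h v)
    (h_sub : forall u v, 1 <= u -> 1 <= v -> h (u + v) <= h u + h v)
    (u x : R) : 1 <= u -> 1 <= x -> h x <= (x / u + 1) * h u.
Proof.
move=> u1 x1; have u0 : 0 < u by rewrite (lt_le_trans _ u1).
have xu0 : 0 <= x / u by rewrite divr_ge0 ?(ltW u0) ?(le_trans _ x1).
have /andP[nx xn] := truncn_itv xu0; set n := Num.truncn _ in nx xn.
apply: (le_trans (h_nd x (u *+ n.+1) x1 _)).
  by rewrite -mulr_natl -ler_pdivrMr // ltW.
apply: le_trans (subadditive_mulrn _ _ h_sub _ n u1) _.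
by rewrite -mulr_natl ler_wpM2r ?h_ge0 // -natr1 lerD2r.
Qed.

(** A form of Fekete's lemma on a half-line. Taking [A] to be the infimum of the quotients makes the
    lower bound immediate and leaves only the convergence to prove. *)
Lemma nd_subadditive_ratio (R : realType) (h : R -> R)
    (h_ge0 : forall u, 1 <= u -> 0 <= h u)
    (h_nd : forall u v, 1 <= u -> u <= v -> h u <= h v)
    (h_sub : forall u v, 1 <= u -> 1 <= v -> h (u + v) <= h u + h v) :
  exists A : R,
    [/\ h x / x @[x --> +oo] --> A,
        has_sup [set h x / x | x in `[1, +oo[]
      & forall x, 1 <= x -> A * x <= h x].
Proof.
have h_le := nd_subadditive_le _ _ h_ge0 h_nd h_sub.
set Q := [set h x / x | x in `[1, +oo[].
have Qne : Q !=set0 by exists (h 1 / 1), 1 => //=; rewrite in_itv /= lexx.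
have Qlb : lbound Q 0.
  apply/lbP=> y [x /=]; rewrite in_itv /= andbT => x1 <-.
  by rewrite divr_ge0 ?h_ge0 // (le_trans _ x1).
(* At u = 1, [h_le] gives h x <= (x + 1) * h 1, and x + 1 <= 2 * x. *)
have Qub : ubound Q (2 * h 1).
  apply/ubP=> y [x /=]; rewrite in_itv /= andbT => x1 <-.
  rewrite ler_pdivrMr ?(lt_le_trans _ x1) //.
  apply: le_trans (h_le 1 x _ x1) _ => //.
  by rewrite divr1 mulrAC ler_wpM2r ?h_ge0 //; lra.
have Qinf : has_inf Q by split => //; exists 0.
have infQ x : 1 <= x -> inf Q <= h x / x.
  move=> x1; apply: ge_inf; first by exists 0.
  by exists x => //=; rewrite in_itv /= x1.
exists (inf Q); split => //; last 2 first.
- by split => //; exists (2 * h 1).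
- by move=> x x1; rewrite -ler_pdivlMr ?(lt_le_trans _ x1) // infQ.
apply/cvgrPdist_lt => e e0.
(* Dividing [h_le] by x gives h x / x <= h u / u + h u / x. One half of [e] pays for choosing u with
   h u / u near the infimum, the other for h u / x, which is small once x is large. *)
have e20 : 0 < e / 2 by rewrite divr_gt0.
have [_ [u /= + <-] hu] := inf_adherent e20 Qinf.
rewrite in_itv /= andbT => u1.
near=> x.
have x1 : 1 <= x by near: x; apply: nbhs_pinfty_ge; rewrite num_real.
have x0 : 0 < x by rewrite (lt_le_trans _ x1).
have hux : h u / x < e / 2.
  rewrite ltr_pdivrMr // mulrC -ltr_pdivrMr //.
  by near: x; apply: nbhs_pinfty_gt; rewrite num_real.
rewrite distrC ger0_norm ?subr_ge0 ?infQ //.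
have : h x / x <= h u / u + h u / x.
  rewrite ler_pdivrMr // mulrDl divfK ?gt_eqF // (le_trans (h_le u x u1 x1))//.
  by rewrite mulrDl mul1r lerD2r mulrAC [leRHS]mulrAC (mulrC x).
lra.
Unshelve. all: by end_near.
Qed.

(** If y were not attained, the values below y would form a nonempty, relatively open and closed
    part of the connected image, hence all of it, against y <= f a. *)
Lemma ereal_IVT (R : realType) (f : R -> \bar R) (a b : R) (y : \bar R) :
  a <= b -> {within `[a, b], continuous f} -> (f b <= y <= f a)%E ->
  exists2 x, x \in `[a, b] & f x = y.
Proof.
move=> ab cf /andP[fby yfa].
have fa_ab : (f @` `[a, b]) (f a).
  by exists a => //=; rewrite in_itv /= lexx ab.
have fb_ab : (f @` `[a, b]) (f b).
  by exists b => //=; rewrite in_itv /= lexx ab.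
have [|y_neq] := pselect ((f @` `[a, b]) y); first by case=> x ? <-; exists x.
have fb_neq : f b != y.
  by apply/eqP => fb; apply: y_neq; rewrite -fb.
have f_conn := connected_continuous_connected (@segment_connected _ a b) cf.
suff E : f @` `[a, b] `&` [set z | (z < y)%E] = f @` `[a, b].
  by move: fa_ab; rewrite -E => -[_ /=]; rewrite ltNge yfa.
apply: f_conn.
- by exists (f b); split; [exact: fb_ab|rewrite /= lt_neqAle fb_neq].
- by exists [set z | (z < y)%E] => //; exact: open_ereal_lt_ereal.
(* Since y is not attained, the closed condition z <= y cuts out the same part of the image as z <
   y. *)
- exists [set z | (z <= y)%E]; first exact: closed_ereal_ge_ereal.
  apply/seteqP; split=> z [Az /= zy]; split => //=; first exact: ltW.
  by rewrite lt_neqAle zy andbT; apply/eqP => zy'; apply: y_neq; rewrite -zy'.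
Qed.

Lemma generator_le (R : realType) (S : R -> R -> R) (s : R -> \bar R)
    (s_gen : is_normalized_generator S s) (x y : R) :
  x \in `[0, 1] -> y \in `[0, 1] -> (s y <= s x)%E = (x <= y).
Proof.
move=> x01 y01; case: (ltgtP x y) => [xy|yx|->]; last by rewrite lexx.
- by rewrite ltW // (generator_decr s_gen.1).
- by apply/negbTE; rewrite -ltNge (generator_decr s_gen.1).
Qed.

Lemma generator_invK (R : realType) (S : R -> R -> R) (s : R -> \bar R)
    (s_gen : is_normalized_generator S s) (y : \bar R) :
  (1%:E <= y)%E -> s (generator_inv s y) = y.
Proof.
move=> y1; apply: pinvK; apply/mem_set.
have [|x x01 <-] := @ereal_IVT R s 0 1 y ler01 (generator_continuous s_gen.1).
  by rewrite s_gen.2 y1 (generator0 s_gen.1) leey.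
by exists x.
Qed.

Lemma generator_inv_itv (R : realType) (S : R -> R -> R) (s : R -> \bar R)
    (s_gen : is_normalized_generator S s) (y : \bar R) :
  (1%:E <= y)%E -> generator_inv s y \in `[0, 1].
Proof.
move=> y1.
have [|x x01 <-] := @ereal_IVT R s 0 1 y ler01 (generator_continuous s_gen.1).
  by rewrite s_gen.2 y1 (generator0 s_gen.1) leey.
(* Injectivity of s on [0, 1] comes from [generator_le] applied in both directions. *)
rewrite /generator_inv pinvKV ?inE // => u v /set_mem u01 /set_mem v01 suv.
by apply/eqP; rewrite eq_le -!(generator_le _ _ _ s_gen) // suv lexx.
Qed.

Lemma generator_ge1 (R : realType) (S : R -> R -> R) (s : R -> \bar R)
    (s_gen : is_normalized_generator S s) (x : R) :
  x \in `[0, 1] -> (1%:E <= s x)%E.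
Proof.
move=> x01; rewrite -s_gen.2 (generator_le _ _ _ s_gen) //; last first.
  by rewrite in_itv /= ler01 lexx.
by move: x01; rewrite in_itv => /andP[].
Qed.

(** The sum s x + s y is at least 1, so it lies in the range where s undoes [generator_inv]. *)
Lemma generator_op (R : realType) (S : R -> R -> R) (s : R -> \bar R)
    (s_gen : is_normalized_generator S s) (x y : R) :
  x \in `[0, 1] -> y \in `[0, 1] -> s (S x y) = (s x + s y)%E.
Proof.
move=> x01 y01; rewrite (generatorE s_gen.1) // (generator_invK _ _ _ s_gen) //.
rewrite (le_trans (generator_ge1 _ _ _ s_gen _ x01)) // leeDl //.
by rewrite (generator_ge0 s_gen.1).
Qed.

(** By strict decrease, the value +oo = s 0 is taken only at 0. *)
Lemma generator_fin_num (R : realType) (S : R -> R -> R) (s : R -> \bar R)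
    (s_gen : is_normalized_generator S s) (x : R) :
  x \in `[0, 1] -> (s x \is a fin_num) = (x != 0).
Proof.
move=> x01; rewrite ge0_fin_numE ?(generator_ge0 s_gen.1) //.
have i0 : 0 \in `[0, 1 : R] by rewrite in_itv /= ler01 lexx.
rewrite -(generator0 s_gen.1) ltNge (generator_le _ _ _ s_gen) //.
rewrite -ltNge lt_neqAle eq_sym.
by move: x01; rewrite in_itv /= => /andP[-> _]; rewrite andbT.
Qed.

Theorem proposition4p3 (R : realType) (S1 S2 : R -> R -> R)
    (s1 s2 : R -> \bar R)
    (S1_proper : is_proper_tsubnorm S1) (S2_proper : is_proper_tsubnorm S2)
    (S1_cont : continuous_op S1) (S2_cont : continuous_op S2)
    (S1_canc : is_cancellative S1) (S2_canc : is_cancellative S2)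
    (s1_gen : is_normalized_generator S1 s1)
    (s2_gen : is_normalized_generator S2 s2)
    (S1_le_S2 : forall x y : R, x \in `[0, 1] -> y \in `[0, 1] ->
      S1 x y <= S2 x y) :
  exists A B : R,
    [/\ (s1 (generator_inv s2 x%:E) / x%:E)%E @[x --> +oo] --> A%:E,
        ereal_sup [set (s1 (generator_inv s2 x%:E) / x%:E)%E | x in `[1, +oo[]
          = B%:E
      & forall x : R, 1 <= x ->
          (A%:E * x%:E <= s1 (generator_inv s2 x%:E) <= B%:E * x%:E)%E].

Proof.
have inv_itv x : 1 <= x -> generator_inv s2 x%:E \in `[0, 1].
  by move=> x1; apply: (generator_inv_itv _ _ _ s2_gen).
have inv_K x : 1 <= x -> s2 (generator_inv s2 x%:E) = x%:E.
  by move=> x1; apply: (generator_invK _ _ _ s2_gen).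
have inv_neq0 x : 1 <= x -> generator_inv s2 x%:E != 0.
  move=> x1; rewrite -(generator_fin_num _ _ _ s2_gen) ?inv_itv //.
  by rewrite inv_K.
(* For x >= 1 the inner point is nonzero, so [s1] is finite there and [fine] loses nothing. *)
pose h x := fine (s1 (generator_inv s2 x%:E)).
have hE x : 1 <= x -> s1 (generator_inv s2 x%:E) = (h x)%:E.
  move=> x1; rewrite fineK // (generator_fin_num _ _ _ s1_gen) ?inv_itv //.
  exact: inv_neq0.
have h_ge0 u : 1 <= u -> 0 <= h u.
  by move=> u1; rewrite fine_ge0 // (generator_ge0 s1_gen.1) ?inv_itv.
have h_nd u v : 1 <= u -> u <= v -> h u <= h v.
  move=> u1 uv; have v1 := le_trans u1 uv.
  rewrite -lee_fin -!hE // (generator_le _ _ _ s1_gen) ?inv_itv //.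
  by rewrite -(generator_le _ _ _ s2_gen) ?inv_itv // !inv_K // lee_fin.
(* With a, b the images of u, v under the inverse of [s2], h (u + v) = s1 (S2 a b) and h u + h v =
   s1 (S1 a b); as [s1] is decreasing, S1 <= S2 concludes. *)
have h_sub u v : 1 <= u -> 1 <= v -> h (u + v) <= h u + h v.
  move=> u1 v1; have uv1 : 1 <= u + v by rewrite ler_wpDr // (le_trans _ v1).
  rewrite -lee_fin EFinD -!hE // -(generator_op _ _ _ s1_gen) ?inv_itv //.
  rewrite EFinD -(inv_K u) // -(inv_K v) // -(generatorE s2_gen.1) ?inv_itv //.
  (* Rewriting with [inv_K] also expanded u and v inside [generator_inv]; this restores them. *)
  have inv_inv w : 1 <= w -> generator_inv s2 (s2 (generator_inv s2 w%:E)) =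
      generator_inv s2 w%:E by move=> w1; rewrite inv_K.
  rewrite !inv_inv // (generator_le _ _ _ s1_gen) ?S1_le_S2 ?inv_itv //.
    exact: tsubnorm_itv S1_proper.1 _ _ (inv_itv _ u1) (inv_itv _ v1).
  exact: tsubnorm_itv S2_proper.1 _ _ (inv_itv _ u1) (inv_itv _ v1).
have ratioE x : 1 <= x -> (s1 (generator_inv s2 x%:E) / x%:E)%E = (h x / x)%:E.
  by move=> x1; rewrite hE // inver gt_eqF ?(lt_le_trans _ x1) //.
have [A [hA hsup Ah]] := nd_subadditive_ratio _ _ h_ge0 h_nd h_sub.
exists A, (sup [set h x / x | x in `[1, +oo[]); split.
- have hAE : (h x / x)%:E @[x --> +oo] --> A%:E by exact: (cvg_comp _ EFin hA).
  apply: cvg_trans hAE.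
  apply: near_eq_cvg; near=> x.
  have x1 : 1 <= x by near: x; apply: nbhs_pinfty_ge; rewrite num_real.
  by rewrite ratioE.
- rewrite -ereal_sup_EFin; [|exact: hsup.2|exact: hsup.1].
  rewrite image_comp; congr ereal_sup; apply: eq_imagel => x /=.
  by rewrite in_itv /= andbT => x1; rewrite ratioE.
- move=> x x1; rewrite hE // -!EFinM !lee_fin Ah //=.
  rewrite -ler_pdivrMr ?(lt_le_trans _ x1) //; apply: ub_le_sup hsup.2 _ _.
  by exists x => //=; rewrite in_itv /= x1.
Unshelve. all: by end_near.
Qed.
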